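(* Let $m\ge 1$ and let $i,j\in\{0,\dots,2^m-1\}$ with $i\ne j$. Then $R_{i\leftrightarrow j}^{-1}=R_{i\leftrightarrow j}$, i.e. $R_{i\leftrightarrow j}R_{i\leftrightarrow j}=I$.
   Context: Rows and columns of $2^m\times 2^m$ complex matrices are indexed from $0$ to $2^m-1$. For $i\ne j$, $R_{i\leftrightarrow j}$ is the $2^m\times 2^m$ row-switching elementary matrix: the matrix obtained from the identity matrix by exchanging rows $i$ and $j$. $I$ is the $2^m\times 2^m$ identity matrix. *)

(* Defs.v *)
From HB Require Import structures.
From mathcomp Require Import all_boot all_order all_algebra.
From mathcomp Require Import reals.
From mathcomp Require Import complex.

Set Implicit Arguments.
Unset Strict Implicit.
Unset Printing Implicit Defensive.

Import GRing.Theory.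
Local Open Scope ring_scope.

(* In the type, [R[i]] is the field of complex numbers over R; its [i] is part of
   the notation and is unrelated to the row index. *)
Definition row_switch (R : realType) (m : nat) (i j : 'I_(2 ^ m)) :
    'M[R[i]]_(2 ^ m) :=
  xrow i j 1%:M.

(* Main.v *)
Require Import Defs.
From HB Require Import structures.
From mathcomp Require Import all_boot all_order all_algebra.
From mathcomp Require Import reals.
From mathcomp Require Import complex.
From mathcomp Require Import perm.

Set Implicit Arguments.
Unset Strict Implicit.
Unset Printing Implicit Defensive.

Import GRing.Theory.
Local Open Scope ring_scope.

Theorem proposition4p3 (R : realType) (m : nat) (hm : (1 <= m)%N)
    (i j : 'I_(2 ^ m)) (hij : i != j) :
  [/\ row_switch R i j \in unitmx,
      invmx (row_switch R i j) = row_switch R i j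
    & row_switch R i j *m row_switch R i j = 1%:M].
Proof.
have sqr1 : row_switch R i j *m row_switch R i j = 1%:M.
  (* [xrow] unfolds to [row_perm] by a transposition, so [row_switch R i j] is convertible to the
     permutation matrix of [tperm i j]. As [perm_mx] is multiplicative, its square is the matrix of
     a squared transposition, the identity. *)
  by rewrite -[row_switch R i j]/(perm_mx (tperm i j)) -perm_mxM tperm2 perm_mx1.
have [unitA _] := mulmx1_unit sqr1; split=> //.
(* With A the switching matrix, the right-hand A is expanded to [invmx A *m (A *m A)], where the
   inner square collapses to 1. *)
by rewrite -[RHS](mulKmx unitA) sqr1 mulmx1.
Qed.
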